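(* Let $n\geq 1$ and $1\leq r\leq n+1$ be integers, and let $x,t,z$ be indeterminates. Let $\mathcal{P}_{n+1}^{(r)}$ be the set of plane trees on $[n+1]$ with root $r$. Then $$\sum_{T\in \mathcal{P}_{n+1}^{(r)}}x^{\mathrm{young}_{T}(r)}\,(t-z)^{\mathrm{eld}(T)}\, z^{\,n-\mathrm{young}_{T}(r)-\mathrm{eld}(T)}=x\prod_{k=1}^{n-1}\bigl(x+(n-k)z+kt\bigr).$$
   Context: $[n+1]=\{1,2,\dots,n+1\}$. A plane tree on $[n+1]$ is a labeled rooted tree with vertex set $[n+1]$ in which the children of each vertex are linearly ordered (from left to right). A vertex $j$ is a descendant of $i$ if $i$ lies on the unique path from the root to $j$; in particular every vertex is a descendant of itself. Let $\beta_T(i)$ be the smallest descendant of $i$ in $T$. Vertices with the same father are brothers. A vertex $j$ is an elder vertex if it has a brother $k$ to its right with $\beta_T(k)<\beta_T(j)$; otherwise it is a younger vertex. $\mathrm{young}_T(i)$ denotes the number of children of $i$ in $T$ that are younger vertices, and $\mathrm{eld}(T)$ denotes the total number of elder vertices of $T$. An empty product equals $1$. *)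

(* Defs.v *)
From HB Require Import structures.
From mathcomp Require Import all_boot all_order all_algebra.
From mathcomp Require Import mpoly.

Set Implicit Arguments.
Unset Strict Implicit.
Unset Printing Implicit Defensive.

Import GRing.Theory.

(* Vertices are elements of 'I_n.+1; the label i + 1 of [n+1] is the ordinal
   of value i (only the order of the labels matters). A plane tree is encoded
   by its lists of children, ordered from left to right. The bound n on their
   lengths loses nothing: the children of a vertex are distinct and never
   include the root. *)
Definition child_lists (n : nat) := {ffun 'I_n.+1 -> {bseq n of 'I_n.+1}}.

Definition child n (T : child_lists n) : rel 'I_n.+1 :=
  fun i j => j \in T i.

(* No repetition among the children of a vertex, exactly one father for each
   non-root vertex and none for the root, all vertices reachable from r. *)
Definition is_plane_tree n (r : 'I_n.+1) (T : child_lists n) : bool :=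
  [&& [forall i, uniq (T i)],
      [forall j, #|[set i | child T i j]| == (j != r)]
    & [forall j, connect (child T) r j]].

Definition plane_trees n (r : 'I_n.+1) : {set child_lists n} :=
  [set T | is_plane_tree r T].

Definition root_path n (r : 'I_n.+1) (T : child_lists n) (j : 'I_n.+1)
    (p : seq 'I_n.+1) : bool :=
  [&& path (child T) r p, uniq (r :: p) & last r p == j].

(* j is a descendant of i: i lies on the path from the root r to j. A simple
   path has at most n edges, whence the bound. *)
Definition descendant n (r : 'I_n.+1) (T : child_lists n) (i j : 'I_n.+1) :
    bool :=
  [exists p : {bseq n of 'I_n.+1}, root_path r T j p && (i \in r :: p)].

(* The seed i of the arg min is harmless: in a tree, i is a descendant of
   itself. *)
Definition beta n (r : 'I_n.+1) (T : child_lists n) (i : 'I_n.+1) : 'I_n.+1 :=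
  [arg min_(j < i | descendant r T i j) (j : nat)].

Definition right_brother n (T : child_lists n) (j k : 'I_n.+1) : bool :=
  [exists i, [&& child T i j, child T i k & index j (T i) < index k (T i)]].

Definition elder n (r : 'I_n.+1) (T : child_lists n) (j : 'I_n.+1) : bool :=
  [exists k, right_brother T j k && (beta r T k < beta r T j)].

Definition younger n (r : 'I_n.+1) (T : child_lists n) (j : 'I_n.+1) : bool :=
  ~~ elder r T j.

Definition young n (r : 'I_n.+1) (T : child_lists n) (i : 'I_n.+1) : nat :=
  #|[set j | child T i j & younger r T j]|.

Definition eld n (r : 'I_n.+1) (T : child_lists n) : nat :=
  #|[set j | elder r T j]|.

Definition x : {mpoly int[3]} := 'X_(inord 0).
Definition t : {mpoly int[3]} := 'X_(inord 1).
Definition z : {mpoly int[3]} := 'X_(inord 2).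

(* Main.v *)
Require Import Defs.
From HB Require Import structures.
From mathcomp Require Import all_boot all_order all_algebra.
From mathcomp Require Import mpoly.

(** Write e for t - z.  The weight of a plane tree is a product over its
    non-root vertices: an elder vertex contributes e, a younger one x if its
    father is the root and z otherwise.

    Fix the underlying unordered tree, that is, the map f sending each vertex
    to its father (and the root to itself).  It determines every beta, and
    brothers have distinct betas because their sets of descendants are
    disjoint.  A plane tree over f is then an independent choice, at each
    vertex, of an order on its d children, in which the younger children are
    the right-to-left minima of beta.  Building the order from the left, the
    first child is younger exactly when it has the least beta, so the orders
    of d children have total weight y (y + e) ... (y + (d - 1) e), where y is
    x at the root and z elsewhere ([sum_list_weight]).  Call this the rising
    factorial y^(d).

    It remains to sum the products of these rising factorials over all f.
    More generally, let y be any weight on vertices, and consider the forests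
    with root set S whose non-root vertices form A.  The sum over them of the
    products of y_v^(d_v), where v has d_v children, is a function of Y_S and
    Y_A, the total weights of S and A ([sum_forest]):
      (Y_S + Y_A)^(|A|) - Y_A (Y_S + Y_A + e)^(|A| - 1),
    which is Y_S (Y_S + Y_A + e)^(|A| - 1) when A is not empty: Cayley's
    formula with powers replaced by rising factorials.  The proof removes a
    root s together with the choice of its set B of children, which become
    roots ([forest_graft], [sum_forest_rec]); the resulting sum over B is
    evaluated by the Vandermonde identity ([rising_vandermonde]).  For S = {r},
    Y_S = x and Y_A = n z this gives x (x + n z + e)^(n - 1), and
    n z + k e = (n - k) z + k t. *)

Set Implicit Arguments.
Unset Strict Implicit.
Unset Printing Implicit Defensive.

Import GRing.Theory.

Local Open Scope ring_scope.

(** * Sums over subsets and rising factorials *)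

Lemma sum_subset_setU1 (W : nmodType) (V : finType) (v : V) (A : {set V})
    (F : {set V} -> W) :
    v \notin A ->
  \sum_(B : {set V} | B \subset v |: A) F B =
    \sum_(B : {set V} | B \subset A) (F (v |: B) + F B).
Proof.
move=> vA; rewrite (bigID (fun B : {set V} => v \in B)) big_split /=.
congr (_ + _).
  rewrite (reindex_onto (fun B => v |: B) (fun B => B :\ v)) /=; last first.
    by move=> B /andP[_ vB]; rewrite setD1K.
  apply: eq_bigl => B; rewrite setU11 andbT.
  apply/andP/idP => [[sB /eqP eB]|sB].
    by rewrite -eB subDset.
  by split; rewrite ?setUS // setU1K ?eqxx //; apply: contra vA; apply: subsetP.
apply: eq_bigl => B; apply/andP/idP => [[sB vB]|sB].
  apply/subsetP => u uB; have := subsetP sB u uB.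
  by rewrite in_setU1 => /predU1P[eu|//]; rewrite -eu uB in vB.
split; first exact: subset_trans sB (subsetU1 _ _).
by apply: contra vA; apply: subsetP.
Qed.

Section Rising.
Variable R : comNzRingType.
Implicit Types a c e : R.

Definition rising e a m : R := \prod_(k < m) (a + e *+ k).

Lemma rising0 e a : rising e a 0 = 1.
Proof. by rewrite /rising big_ord0. Qed.

Lemma risingS e a m : rising e a m.+1 = rising e a m * (a + e *+ m).
Proof. by rewrite /rising big_ord_recr. Qed.

Lemma risingSl e a m : rising e a m.+1 = a * rising e (a + e) m.
Proof.
rewrite /rising big_ord_recl mulr0n addr0; congr (_ * _).
by apply: eq_bigr => k _; rewrite mulrS addrA.
Qed.

(** Vandermonde's identity, with subsets in place of binomial coefficients.
    Deciding whether one more element v belongs to B multiplies each term by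
    a + |B| e or by c + |A \ B| e; these two factors add up to
    a + c + |A| e whatever B is. *)
Lemma rising_vandermonde (V : finType) (A : {set V}) e a c :
  \sum_(B : {set V} | B \subset A) rising e a #|B| * rising e c #|A :\: B| =
    rising e (a + c) #|A|.
Proof.
elim: {A}#|A| {-2}A (erefl #|A|) => [|m IHm] A.
  move/eqP; rewrite cards_eq0 => /eqP->.
  rewrite (eq_bigl (pred1 set0)) => [|B]; last by rewrite subset0.
  by rewrite big_pred1_eq setD0 !cards0 !rising0 mulr1.
move=> cA; have [v vA] : exists v, v \in A by apply/card_gt0P; rewrite cA.
have cAv : #|A :\ v| = m by move: (cardsD1 v A); rewrite vA cA => -[].
rewrite -{1}(setD1K vA) sum_subset_setU1 ?setD11 // cA risingS -cAv -(IHm _ cAv).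
rewrite cAv mulr_suml; apply: eq_bigr => B sB.
have vB : v \notin B by apply/negP => /(subsetP sB); rewrite setD11.
rewrite cardsU1 vB add1n risingS.
have -> : A :\: (v |: B) = (A :\ v) :\: B.
  by apply/setP => u; rewrite !inE negb_or; case: (u == v); case: (u \in B).
have -> : #|A :\: B| = #|(A :\ v) :\: B|.+1.
  rewrite (cardsD1 v) !inE vA vB /= add1n; congr _.+1.
  by apply: eq_card => u; rewrite !inE; case: (u == v); case: (u \in B).
rewrite risingS -cAv -(subnKC (subset_leq_card sB)) -cardsDS // mulrnDr.
set p := rising e a _; set q := rising e c _; set i := e *+ _; set j := e *+ _.
by rewrite mulrAC mulrA -mulrDr addrACA.
Qed.
End Rising.

(** * Rooted forests *)

Section Forests.
Variable V : finType.
Implicit Types (S A B : {set V}) (f h : {ffun V -> V}).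

(** A forest is encoded by its father map.  The vertices outside A, in
    particular the roots in S, are sent to themselves; this makes the encoding
    unique and forces the father of a vertex of A to lie in S or A. *)
Definition forest S A f :=
  [forall (v | v \notin A), f v == v] &&
  [forall v in A, [exists s in S, fconnect f v s]].

Lemma forestP S A f :
  reflect ((forall v, v \notin A -> f v = v) /\
           (forall v, v \in A -> exists k, iter k f v \in S))
          (forest S A f).
Proof.
apply: (iffP andP) => -[fixf rootf]; split.
- by move=> v vA; apply/eqP; exact: (forall_inP fixf).
- move=> v /(forall_inP rootf)/exists_inP[s sS /iter_findex es].
  by exists (findex f v s); rewrite es.
- by apply/forall_inP => v /fixf->.
apply/forall_inP => v /rootf[k kS]; apply/exists_inP.
by exists (iter k f v) => //; apply: fconnect_iter.
Qed.

Definition graft (s : V) B h := [ffun v => if v \in B then s else h v].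
Definition prune B f := [ffun v => if v \in B then v else f v].

(** Cutting the edges from s to its set B of children turns a forest into one
    in which the vertices of B are roots and s is isolated.  Conversely B can
    be grafted onto s: no cycle appears, since s is a root. *)
Lemma forest_graft S A B s h :
    [disjoint S & A] -> s \in S -> B \subset A ->
  [&& forest S A (graft s B h), [set v in A | graft s B h v == s] == B
    & prune B (graft s B h) == h]
  = forest (S :\ s :|: B) (A :\: B) h.
Proof.
move=> dSA sS sBA.
have dis v : v \in S -> v \notin A by move/(disjointFr dSA)->.
have sB : s \notin B by apply: contra (dis s sS); apply: subsetP.
set f := graft s B h.
have fB v : v \in B -> f v = s by rewrite ffunE => ->.
have fh v : v \notin B -> f v = h v by rewrite ffunE => /negbTE->.
apply/and3P/forestP.
  case=> /forestP[fixf rootf] /eqP eB /eqP eh; split.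
    move=> v; rewrite inE; have [vB _|vB /= vA] := boolP (v \in B).
      by rewrite -eh ffunE vB.
    by rewrite -fh ?(negbTE vB) // fixf.
  move=> v; rewrite inE => /andP[vB vA]; have [k] := rootf v vA.
  elim: k v vB vA => [|k IHk] v vB vA kS.
    by case/negP: (dis _ kS).
  rewrite iterSr in kS.
  (* Otherwise v would be one of the children of s, and so lie in B. *)
  have fvs : f v != s by apply: contra vB => fvs; rewrite -eB inE vA.
  have [fvB | fvB] := boolP (f v \in B).
    by exists 1%N; rewrite /= -fh // inE fvB orbT.
  have [fvA | fvA] := boolP (f v \in A).
    by have [i iS] := IHk _ fvB fvA kS; exists i.+1; rewrite iterSr -fh.
  have ek i : iter i f (f v) = f v by elim: i => //= i ->; apply: fixf.
  by exists 1%N; rewrite /= -fh // !inE fvs -(ek k) kS.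
case=> fixh rooth.
have BP v : v \in B -> h v = v by move=> vB; rewrite fixh // inE vB.
split.
- apply/forestP; split=> v vA.
    have vB : v \notin B by apply: contra vA; apply: subsetP.
    by rewrite fh // fixh // inE negb_and vA orbT.
  have [vB | vB] := boolP (v \in B); first by exists 1%N; rewrite /= fB.
  have /rooth[k] : v \in A :\: B by rewrite inE vB.
  elim: k v vB {vA} => [|k IHk] v vB.
    by rewrite !inE (negbTE vB) orbF => /andP[_ vS]; exists 0%N.
  rewrite iterSr; have [hvB | hvB] := boolP (h v \in B).
    by move=> _; exists 2%N; rewrite /= (fh v vB) fB.
  by case/(IHk _ hvB) => i iS; exists i.+1; rewrite iterSr fh.
- apply/eqP/setP => v; rewrite inE.
  apply/andP/idP => [[vA /eqP fvs] | vB]; last by rewrite (subsetP sBA) ?fB.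
  apply: contraT => vB; have /rooth[k] : v \in A :\: B by rewrite inE vB.
  rewrite fh // in fvs.
  (* A child v of s outside B would be stuck at s, which is not a root of h. *)
  have hs : h s = s by rewrite fixh // inE negb_and dis ?orbT.
  have hk i : iter i h s = s by elim: i => //= i ->.
  case: k => [|k]; last by rewrite iterSr fvs hk !inE eqxx (negbTE sB).
  rewrite /= !inE (negbTE vB) orbF => /andP[_ vS].
  by rewrite (negbTE (dis v vS)) in vA.
apply/eqP/ffunP => v; rewrite !ffunE.
by have [/BP|] := boolP (v \in B).
Qed.

Variable R : comNzRingType.
Implicit Types (e : R) (y : V -> R).

Definition forest_weight e y S A f :=
  \prod_(v in S :|: A) rising e (y v) #|[set u in A | f u == v]|.

Lemma forest_weight_graft e y S A B s h :
    [disjoint S & A] -> s \in S -> B \subset A ->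
    [set v in A | graft s B h v == s] = B ->
  forest_weight e y S A (graft s B h) =
    rising e (y s) #|B| * forest_weight e y (S :\ s :|: B) (A :\: B) h.
Proof.
move=> dSA sS sBA eB; rewrite /forest_weight (bigD1 s) ?inE ?sS //= eB.
have sA : s \notin A by rewrite (disjointFr dSA sS).
congr (_ * _); apply: eq_big => [v | v /andP[_ vs]].
  rewrite !inE; have [->|_] := eqVneq; last first.
    have [vB|] := boolP (v \in B); last by rewrite andbT orbF.
    by rewrite (subsetP sBA) ?orbT.
  rewrite (negbTE sA) !andbF; apply/esym/negP => /orP[] // /(subsetP sBA).
  by rewrite (negbTE sA).
congr (rising _ _ _); apply: eq_card => u; rewrite !inE ffunE.
have [uB|//] := boolP (u \in B).
by rewrite /= [s == v]eq_sym (negbTE vs) andbF.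
Qed.

Lemma sum_forest_rec e y S A s :
    [disjoint S & A] -> s \in S ->
  \sum_(f | forest S A f) forest_weight e y S A f =
  \sum_(B : {set V} | B \subset A) rising e (y s) #|B| *
    \sum_(h | forest (S :\ s :|: B) (A :\: B) h)
      forest_weight e y (S :\ s :|: B) (A :\: B) h.
Proof.
move=> dSA sS.
rewrite (partition_big (fun f : {ffun V -> V} => [set v in A | f v == s])
                       (fun B => B \subset A)) /=; last first.
  by move=> f _; apply/subsetP=> v; rewrite inE => /andP[].
apply: eq_bigr => B sBA; rewrite big_distrr /=.
rewrite (reindex_onto (graft s B) (prune B)) /=; last first.
  move=> f /andP[_ /eqP eB]; apply/ffunP => v; rewrite !ffunE.
  by have [|//] := boolP (v \in B); rewrite -eB inE => /andP[_ /eqP].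
apply: eq_big => [h | h].
  by rewrite -andbA forest_graft.
by case/andP=> /andP[_ /eqP eB] _; apply: forest_weight_graft.
Qed.

(** Cayley's formula for forests, in terms of rising factorials.  The right
    hand side is yS * rising e (yS + yA + e) #|A|.-1 when A is not empty; the
    difference also covers A = set0.  Moreover it is linear in yA once yS + yA
    is known, and this sum depends on the removed root s but not on the set B
    of its children; hence the sum over B becomes a combination of
    Vandermonde sums over the subsets of A and over those of A :\ v. *)
Lemma sum_forest e y S A :
    [disjoint S & A] ->
  let yS := \sum_(v in S) y v in let yA := \sum_(v in A) y v in
  \sum_(f | forest S A f) forest_weight e y S A f =
    rising e (yS + yA) #|A| - yA * rising e (yS + yA + e) #|A|.-1.
Proof.
elim: {S A}#|S :|: A|.+1 {-2}S {-2}A (ltnSn #|S :|: A|) => // m IHm S A.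
rewrite ltnS => leSAm dSA yS yA.
have [S0 | [s sS]] := set_0Vmem S.
  have {yS}-> : yS = 0 by rewrite /yS S0 big_set0.
  rewrite S0 add0r; have [A0 | [v vA]] := set_0Vmem A.
    rewrite (big_pred1 [ffun v => v]) => [|f]; last first.
      apply/forestP/eqP => [[fixf _] | ->].
        by apply/ffunP=> v; rewrite fixf ?ffunE ?A0 ?inE.
      by split=> v; rewrite ?ffunE // A0 inE.
    by rewrite /forest_weight /yA A0 setU0 !big_set0 cards0 rising0 mul0r subr0.
  rewrite big_pred0 => [|f].
    rewrite (cardsD1 v) vA add1n /= risingSl subrr //.
  by apply/negP => /forestP[_ /(_ v vA)[k]]; rewrite inE.
rewrite (sum_forest_rec e y dSA sS).
have sA : s \notin A by rewrite (disjointFr dSA sS).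
set a := y s; pose w := \sum_(v in S :\ s) y v.
have yS_E : yS = a + w by rewrite /yS (big_setD1 s).
(* The total weight of the vertices that remain once s is removed. *)
pose q := w + yA.
have step (B : {set V}) : B \subset A ->
    rising e a #|B| *
      (\sum_(h | forest (S :\ s :|: B) (A :\: B) h)
        forest_weight e y (S :\ s :|: B) (A :\: B) h) =
    rising e a #|B| * rising e q #|A :\: B| -
    \sum_(v in A | v \notin B)
      y v * (rising e a #|B| * rising e (q + e) #|(A :\ v) :\: B|).
  move=> sBA.
  have dB : [disjoint S :\ s & B].
    rewrite disjoint_subset; apply/subsetP => v; rewrite !inE => /andP[_ vS].
    by apply/negP => /(subsetP sBA); rewrite (disjointFr dSA vS).
  rewrite IHm; first last.
  - rewrite disjoint_subset; apply/subsetP => v; rewrite !inE.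
    case: (v \in B) => //=; rewrite orbF => /andP[_ vS].
    by rewrite (disjointFr dSA vS).
  - apply: leq_trans leSAm; apply: proper_card; apply/properP; split.
      apply/subsetP => v; rewrite !inE.
      have [/(subsetP sBA)->|] := boolP (v \in B); first by rewrite !orbT.
      by rewrite orbF /= => _ /orP[/andP[_ ->]|->]; rewrite ?orbT.
    exists s; rewrite !inE ?sS // eqxx (negbTE sA) andbF /= orbF.
    by apply/negP => /(subsetP sBA); rewrite (negbTE sA).
  have -> : \sum_(v in S :\ s :|: B) y v + \sum_(v in A :\: B) y v = q.
    rewrite (eq_bigl [predU S :\ s & B]) => [|v]; last by rewrite !inE.
    rewrite bigU //= -addrA; congr (_ + _); rewrite /yA [RHS](big_setID B) /=.
    by move/setIidPr: sBA => ->.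
  rewrite mulrBr; congr (_ - _); rewrite mulrCA mulr_suml.
  apply: eq_big => [v | v]; first by rewrite inE andbC.
  rewrite inE => /andP[vB vA]; congr (_ * (_ * rising _ _ _)).
  rewrite (cardsD1 v) !inE vA vB /=; apply: eq_card => u; rewrite !inE.
  by rewrite andbCA.
have aq : a + q = yS + yA by rewrite yS_E /q addrA.
rewrite (eq_bigr _ step) sumrB rising_vandermonde aq; congr (_ - _).
rewrite (exchange_big_dep (fun v => v \in A)) /= => [|B v _ /andP[]//].
rewrite /yA mulr_suml; apply: eq_bigr => v vA; rewrite -big_distrr /=.
rewrite -aq -(addrA a q e) (cardsD1 v A) vA /= -rising_vandermonde.
congr (_ * _); apply: eq_bigl => B.
by rewrite subsetD1.
Qed.
End Forests.

(** * Orders on the children of a vertex *)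

Section Permutations.
Variables (V : finType) (b : V -> nat) (R : comNzRingType).
Implicit Types (l s : seq V) (e y : R).

(** For a list of brothers and b = beta: the elder ones have a smaller value
    of b to their right and weigh e, the others weigh y. *)
Fixpoint list_weight e y s : R :=
  if s is j :: s' then
    (if has (fun k => b k < b j)%N s' then e else y) * list_weight e y s'
  else 1.

Lemma list_weightE e y s : uniq s ->
  list_weight e y s =
  \prod_(j <- s)
    (if has (fun k => (index j s < index k s) && (b k < b j))%N s
     then e else y).
Proof.
elim: s => [|j s IHs] /=; first by rewrite big_nil.
case/andP=> js us; rewrite big_cons /= eqxx /=; congr (_ * _).
  congr (if _ then _ else _); apply: eq_in_has => k ks.
  by case: eqVneq ks js => // <- ->.
rewrite (IHs us) big_seq [RHS]big_seq; apply: eq_bigr => i iS.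
have ij : (j == i) = false by apply: contraNF js => /eqP->.
rewrite ij /=; congr (if _ then _ else _); apply: eq_in_has => k ks.
have -> // : (j == k) = false by apply: contraNF js => /eqP->.
Qed.

Lemma permutations_cons l : uniq l -> (0 < size l)%N ->
  perm_eq (permutations l) [seq j :: s | j <- l, s <- permutations (rem j l)].
Proof.
move=> ul l_gt0; apply: uniq_perm; first exact: permutations_uniq.
  apply: allpairs_uniq_dep => // [j _|]; first exact: permutations_uniq.
  by move=> [j s] [j' s'] _ _ /= [-> ->].
move=> s; rewrite mem_permutations; apply/idP/allpairsPdep.
  case: s => [/perm_size sl|j s Hs]; first by rewrite -sl in l_gt0.
  have jl : j \in l by rewrite -(perm_mem Hs) mem_head.
  exists j, s; split=> //; rewrite mem_permutations -(perm_cons j).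
  exact: perm_trans Hs (perm_to_rem jl).
case=> j [s' [jl]]; rewrite mem_permutations => Hs ->.
rewrite perm_sym; apply: perm_trans (perm_to_rem jl) _.
by rewrite perm_cons perm_sym.
Qed.

(** The weight of the first entry j depends only on j: it is y for the minimum
    of b on l and e for the size l - 1 other entries.  The rest of the list is
    an arbitrary permutation of the remaining entries. *)
Lemma sum_list_weight e y l : uniq l -> {in l &, injective b} ->
  \sum_(s <- permutations l) list_weight e y s = rising e y (size l).
Proof.
elim: {l}(size l) {-2}l (erefl (size l)) => [|m IHm] l.
  by move/size0nil=> ->; rewrite /permutations /= big_seq1 rising0.
move=> sl ul bl; have l_gt0 : (0 < size l)%N by rewrite sl.
rewrite (perm_big _ (permutations_cons ul l_gt0)) big_allpairs_dep /=.
pose wt j := if has (fun k => b k < b j)%N l then e else y.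
have sum_head j : j \in l ->
  \sum_(s <- permutations (rem j l)) list_weight e y (j :: s) =
    wt j * rising e y m.
  move=> jl; have rm : size (rem j l) = m by rewrite size_rem ?sl.
  have rb : {in rem j l &, injective b}.
    by move=> i k /mem_rem il /mem_rem kl; apply: bl.
  rewrite -[in RHS]rm -IHm ?rem_uniq // big_distrr /=.
  rewrite big_seq [RHS]big_seq; apply: eq_bigr => s.
  rewrite mem_permutations => Hs.
  by rewrite /= /wt (perm_has _ Hs) (perm_has _ (perm_to_rem jl)) /= ltnn.
rewrite big_seq (eq_bigr _ sum_head) -big_seq -big_distrl /= sl risingS mulrC.
congr (_ * _).
have [j0 j0l] : exists j, j \in l.
  by case: (l) l_gt0 => // j l' _; exists j; rewrite mem_head.
case: (arg_minnP b j0l) => {j0 j0l}j jl jmin.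
rewrite (perm_big _ (perm_to_rem jl)) big_cons /=.
have -> : wt j = y.
  rewrite /wt; case: hasP => // -[k kl]; rewrite ltnNge.
  by have /= -> := jmin k kl.
congr (_ + _); have -> : m = size (rem j l) by rewrite size_rem ?sl.
rewrite big_seq (eq_bigr (fun=> e)) => [|k].
  by rewrite -big_seq big_const_seq count_predT iter_addr_0.
rewrite mem_rem_uniq // inE => /andP[kj kl].
rewrite /wt; case: hasP => // -[]; exists j => //.
rewrite ltn_neqAle; have /= -> := jmin k kl; rewrite andbT.
by apply: contra kj => /eqP /(bl _ _ jl kl)->.
Qed.

Lemma sum_bseq_perm n l (F : seq V -> R) : (size l <= n)%N ->
  \sum_(s : {bseq n of V} | perm_eq s l) F s = \sum_(s <- permutations l) F s.
Proof.
move=> ln; rewrite -big_filter -(big_map (@bseqval n V) predT F).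
apply: perm_big; apply: uniq_perm; last 1 first.
- move=> s; rewrite mem_permutations; apply/mapP/idP => [[s']|Hs].
    by rewrite mem_filter => /andP[Hs _] ->.
  have sn : (size s <= n)%N by rewrite (perm_size Hs).
  by exists (Bseq sn) => //; rewrite mem_filter mem_index_enum Hs.
- by rewrite map_inj_uniq ?filter_uniq ?index_enum_uniq //; apply: val_inj.
- exact: permutations_uniq.
Qed.
End Permutations.

(** * Plane trees over a father map *)

Section PlaneTrees.
Variables (n : nat) (r : 'I_n.+1).
Implicit Types (f : {ffun 'I_n.+1 -> 'I_n.+1}) (T : child_lists n).

Definition children f i := [set j in [set~ r] | f j == i].

(** The plane trees obtained from the father map f are those that order the
    children of each vertex. *)
Definition orders f T := [forall i, perm_eq (T i) (enum (children f i))].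

(** In a plane tree only the root has no father; it is sent to itself, as in a
    forest with root set {r}. *)
Definition parent T :=
  [ffun j => if [pick i | child T i j] is Some i then i else j].

Lemma orders_child f T : orders f T ->
  forall i j, child T i j = (j != r) && (f j == i).
Proof.
by move/forallP=> oT i j; rewrite /child (perm_mem (oT i)) mem_enum !inE.
Qed.

Lemma forest_root_iter f :
  forest [set r] [set~ r] f -> f r = r /\ forall j, exists k, iter k f j = r.
Proof.
case/forestP=> fixf rootf; split; first by rewrite fixf // !inE eqxx.
move=> j; have [->|jr] := eqVneq j r; first by exists 0%N.
by have [|k] := rootf j; rewrite ?inE // => /eqP; exists k.
Qed.

Lemma plane_tree_parent f T :
  is_plane_tree r T && (parent T == f) =
  forest [set r] [set~ r] f && orders f T.
Proof.
apply/andP/andP=> [[/and3P[/forallP uT /forallP cT /forallP rT] /eqP<-]|[Ff oT]].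
  have chT i j : child T i j = (j != r) && (parent T j == i).
    rewrite /parent ffunE; case: pickP => [i' Ti'j|noT].
      have := cT j; have [_|jr] := eqVneq j r.
        rewrite cards_eq0 => /eqP/setP/(_ i').
        by rewrite !inE Ti'j.
      rewrite /= => /cards1P[i0 Ti0]; move/setP: Ti0 => Ti0.
      have := Ti0 i; have := Ti0 i'; rewrite !inE Ti'j => /esym/eqP-> ->.
      by rewrite eq_sym.
    rewrite noT; have := cT j; have [//|jr] := eqVneq j r.
    by rewrite /= => /cards1P[i0 /setP/(_ i0)]; rewrite !inE eqxx noT.
  have pr : parent T r = r.
    by rewrite ffunE; case: pickP => // i; rewrite chT eqxx.
  split; last first.
    apply/forallP => i; apply: uniq_perm; rewrite ?enum_uniq //.
    by move=> j; rewrite mem_enum !inE -chT.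
  apply/forestP; split=> v; rewrite !inE; first by rewrite negbK => /eqP->.
  move=> vr; have /connectP[p] := rT v.
  move: vr => _; elim/last_ind: p v => [|p u IHp] v.
    by move=> _ /= ->; exists 0%N; rewrite inE.
  rewrite rcons_path last_rcons => /andP[/IHp/(_ erefl)[k kr]] + ->.
  by rewrite chT => /andP[_ /eqP eu]; exists k.+1; rewrite iterSr eu.
have chT := orders_child oT; have [fr fk] := forest_root_iter Ff.
split; last first.
  apply/eqP/ffunP => j; rewrite ffunE; case: pickP => [i|noT].
    by rewrite chT => /andP[_ /eqP].
  by have := noT (f j); rewrite chT eqxx andbT => /negbFE/eqP->.
apply/and3P; split; apply/forallP => j.
- by rewrite (perm_uniq (forallP oT j)) enum_uniq.
- have [->|jr] := eqVneq j r.
    by rewrite cards_eq0; apply/eqP/setP=> i; rewrite !inE chT eqxx.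
  by apply/cards1P; exists (f j); apply/setP=> i; rewrite !inE chT jr eq_sym.
have [k] := fk j; elim: k j => [|k IHk] j; first by move=> /= ->.
rewrite iterSr => /IHk rfj; apply: connect_trans rfj _.
have [->|jr] := eqVneq j r; first by rewrite fr.
by apply: connect1; rewrite chT jr eqxx.
Qed.

Section Fixed.
Variables (f : {ffun 'I_n.+1 -> 'I_n.+1}).
Hypothesis Ff : forest [set r] [set~ r] f.

Lemma root_path_fconnect T p i : orders f T ->
  path (child T) r p -> (i \in r :: p) = fconnect f (last r p) i.
Proof.
move=> oT; elim/last_ind: p => [_|p j IHp] /=.
  rewrite inE eq_sym.
  apply/eqP/idP => [<-|/iter_findex <-]; first exact: connect0.
  by rewrite iter_fix //; case: (forest_root_iter Ff).
rewrite rcons_path last_rcons (orders_child oT).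
case/andP=> /IHp eqp /andP[_ /eqP fj].
by rewrite fconnect_eqVf fj -eqp -rcons_cons mem_rcons inE eq_sym.
Qed.

(** The path from the root to j, read backwards, is the sequence of iterated
    fathers of j. *)
Lemma descendantE T : orders f T ->
  forall i j, descendant r T i j = fconnect f j i.
Proof.
move=> oT i j; apply/existsP/idP => [[p /andP[/and3P[pT _ /eqP<-] ip]]|fji].
  by rewrite -(root_path_fconnect _ oT).
have : is_plane_tree r T.
  by have := plane_tree_parent f T; rewrite Ff oT => /andP[].
case/and3P=> _ _ /forallP/(_ j)/connectP[p0 /shortenP[p pT up _] ej].
have sp : (size p <= n)%N.
  by have := max_card (mem (r :: p)); rewrite card_ord (card_uniqP up).
exists (Bseq sp); rewrite /root_path /= pT -ej eqxx andbT.
by rewrite -/(uniq (r :: p)) up /= (root_path_fconnect _ oT) // -ej.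
Qed.

Definition least_descendant i : 'I_n.+1 :=
  [arg min_(j < i | fconnect f j i) (j : nat)].

Lemma betaE T : orders f T -> beta r T =1 least_descendant.
Proof.
move=> oT i; rewrite /beta /least_descendant.
congr (odflt _ _); apply: eq_pick => j /=; rewrite descendantE //.
by congr (_ && _); apply: eq_forallb => k; rewrite descendantE.
Qed.

(** Iterating around the cycle never leaves it, but leads to the root, which
    is a fixed point. *)
Lemma cyclic_vertex_root v k : iter k.+1 f v = v -> v = r.
Proof.
move=> fv; have [fr /(_ v)[d dr]] := forest_root_iter Ff.
by rewrite -[LHS](iter_fix d fv) -iterM mulnS addnC iterD dr iter_fix.
Qed.

Lemma brothers_antichain j k : j != r -> k != r -> f j = f k ->
  fconnect f j k -> j = k.
Proof.
move=> jr kr fjk; rewrite fconnect_eqVf fjk => /orP[/eqP // | /iter_findex].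
by rewrite -iterSr => /cyclic_vertex_root ekr; rewrite ekr eqxx in kr.
Qed.

(** If two brothers had the same least descendant m, both would be iterated
    fathers of m, so that one would be a descendant of the other. *)
Lemma least_descendant_inj i :
  {in enum (children f i) &, injective (fun j => least_descendant j : nat)}.
Proof.
move=> j k; rewrite !mem_enum !inE => /andP[jr /eqP fj] /andP[kr /eqP fk].
rewrite /least_descendant.
case: arg_minnP => [|m mj _]; first exact: connect0.
case: arg_minnP => [|m' mk _ /val_inj em]; first exact: connect0.
rewrite -{}em in mk.
have [a ea] : exists a, iter a f m = j.
  by exists (findex f m j); apply: iter_findex.
have [c ec] : exists c, iter c f m = k.
  by exists (findex f m k); apply: iter_findex.
wlog leac : j k a c jr kr fj fk {mj mk} ea ec / (a <= c)%N => [IH|].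
  case/orP: (leq_total a c) => ac; first exact: (IH j k a c).
  by symmetry; apply: (IH k j c a).
apply: brothers_antichain; rewrite ?fj ?fk //.
by rewrite -ec -(subnK leac) iterD ea fconnect_iter.
Qed.

End Fixed.
End PlaneTrees.

(** * Weights of plane trees *)

Section Weights.
Variables (R : comNzRingType) (e a c : R) (n : nat) (r : 'I_n.+1).
Implicit Types (f : {ffun 'I_n.+1 -> 'I_n.+1}) (T : child_lists n).

Definition young_child_weight (i : 'I_n.+1) : R := if i == r then a else c.

Definition tree_weight T : R :=
  a ^+ young r T r * e ^+ eld r T * c ^+ (n - young r T r - eld r T).

Lemma elderE f T j : orders r f T -> elder r T j =
  (j != r) && has (fun k => (index j (T (f j)) < index k (T (f j))) &&
                  (beta r T k < beta r T j))%N (T (f j)).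
Proof.
move=> oT; have chT := orders_child oT; apply/existsP/andP.
  case=> k /andP[/existsP[i /and3P[]]]; rewrite chT => /andP[jr /eqP->] ik lt bk.
  by split=> //; apply/hasP; exists k; rewrite ?lt.
case=> jr /hasP[k kT /andP[lt bk]]; exists k; rewrite bk andbT.
by apply/existsP; exists (f j); rewrite chT jr eqxx /child kT lt.
Qed.

Lemma tree_weight_prod f T : orders r f T ->
  tree_weight T = \prod_(j in [set~ r])
    (if elder r T j then e else young_child_weight (f j)).
Proof.
move=> oT; have chT := orders_child oT.
have eldr j : elder r T j -> j != r by rewrite (elderE _ oT) => /andP[].
pose E := [set j in [set~ r] | elder r T j].
pose Y := [set j in [set~ r] | ~~ elder r T j & f j == r].
pose Z := [set j in [set~ r] | ~~ elder r T j & f j != r].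
have eE : eld r T = #|E|.
  apply: eq_card => j; rewrite !inE.
  by apply/idP/andP => [jE|[]//]; rewrite eldr.
have eY : young r T r = #|Y|.
  apply: eq_card => j; rewrite !inE chT -andbA /younger; congr (_ && _).
  exact: andbC.
have eZ : (n - young r T r - eld r T)%N = #|Z|.
  have : #|[set~ r]| = n by rewrite cardsC1 card_ord.
  rewrite -(cardsID [set j | elder r T j]).
  rewrite -[X in (_ + X)%N](cardsID [set j | f j == r]).
  have -> : [set~ r] :&: [set j | elder r T j] = E.
    by apply/setP=> j; rewrite !inE.
  have -> : ([set~ r] :\: [set j | elder r T j]) :&: [set j | f j == r] = Y.
    by apply/setP=> j; rewrite !inE; case: (elder r T j); case: (j == r).
  have -> : ([set~ r] :\: [set j | elder r T j]) :\: [set j | f j == r] = Z.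
    by apply/setP=> j; rewrite !inE; case: (elder r T j); case: (j == r);
      rewrite /= ?andbT ?andbF.
  by rewrite eE eY => en; rewrite -[X in (X - _ - _)%N]en addnCA addKn addKn.
rewrite /tree_weight eZ eE eY (bigID (elder r T)) /=.
rewrite [X in _ = _ * X](bigID (fun j => f j == r)) /=.
rewrite -!prodr_const [X in X * _]mulrC -mulrA.
congr (_ * _).
  by apply: eq_big => [j|j]; rewrite inE // => /andP[_ ->].
congr (_ * _); apply: eq_big => [j|j].
- by rewrite !inE andbA.
- by rewrite inE => /and3P[_ /negbTE-> fj]; rewrite /young_child_weight fj.
- by rewrite !inE andbA.
- by rewrite inE => /and3P[_ /negbTE-> /negbTE fj]; rewrite /young_child_weight fj.
Qed.

(** Once the father map f is fixed, the weight is local to the lists of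
    children, since beta depends on f alone. *)
Lemma tree_weight_lists f T : forest [set r] [set~ r] f -> orders r f T ->
  tree_weight T =
  \prod_i list_weight (fun j => least_descendant f j) e (young_child_weight i) (T i).
Proof.
move=> Ff oT; rewrite (tree_weight_prod oT).
rewrite (partition_big f predT) //=; apply: eq_bigr => i _.
have uT : uniq (T i) by rewrite (perm_uniq (forallP oT i)) enum_uniq.
rewrite list_weightE // big_uniq //=; apply: eq_big => [j|j].
  by rewrite (perm_mem (forallP oT i)) mem_enum !inE.
rewrite !inE => /andP[jr /eqP fj]; rewrite (elderE _ oT) jr fj /=.
congr (if _ then _ else _); apply: eq_has => k.
by rewrite !(betaE Ff oT).
Qed.

Lemma sum_orders f : forest [set r] [set~ r] f ->
  \sum_(T | orders r f T) tree_weight T =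
    forest_weight e young_child_weight [set r] [set~ r] f.
Proof.
move=> Ff; rewrite (eq_bigr _ (fun T => tree_weight_lists Ff)).
rewrite /forest_weight setUCr.
rewrite (eq_bigl (fun T => T \in family (fun i =>
  [pred s : {bseq n of 'I_n.+1} | perm_eq s (enum (children r f i))]))); last first.
  by move=> T; apply/forallP/familyP => h i; have := h i; rewrite inE.
rewrite -(bigA_distr_big_dep
  (fun i (s : {bseq n of 'I_n.+1}) => perm_eq s (enum (children r f i)))
  (fun i (s : {bseq n of 'I_n.+1}) =>
     list_weight (fun j => least_descendant f j) e (young_child_weight i) s)) /=.
apply: eq_big => [i|i _]; first by rewrite inE.
rewrite (sum_bseq_perm (list_weight _ e (young_child_weight i))); last first.
  have cr : #|[set~ r]| = n by rewrite cardsC1 card_ord.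
  by rewrite -cardE -[X in (_ <= X)%N]cr; apply: subset_leq_card;
    apply/subsetP => j; rewrite inE => /andP[].
by rewrite sum_list_weight ?enum_uniq -?cardE //; apply: least_descendant_inj.
Qed.

Lemma sum_plane_trees : (0 < n)%N ->
  \sum_(T in plane_trees r) tree_weight T =
    a * rising e (a + c *+ n + e) n.-1.
Proof.
move=> n_gt0.
rewrite (partition_big (@parent n) (forest [set r] [set~ r])) /=; last first.
  move=> T; rewrite inE => pT.
  by have := plane_tree_parent r (parent T) T; rewrite pT eqxx => /esym/andP[].
rewrite (eq_bigr (forest_weight e young_child_weight [set r] [set~ r])); last first.
  move=> f Ff; rewrite -sum_orders //; apply: eq_bigl => T.
  by rewrite inE plane_tree_parent Ff.
rewrite sum_forest; last by rewrite disjoints1 !inE eqxx.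
rewrite big_set1 cardsC1 card_ord /=.
have -> : \sum_(v in [set~ r]) young_child_weight v = c *+ n.
  rewrite (eq_bigr (fun=> c)) => [|v]; last first.
    by rewrite !inE /young_child_weight => /negbTE->.
  by rewrite sumr_const cardsC1 card_ord.
rewrite /young_child_weight eqxx -{2}(prednK n_gt0) risingSl -mulrBl.
by rewrite addrK.
Qed.
End Weights.

Theorem theorem4p1 (n : nat) (r : 'I_n.+1) (hn : (1 <= n)%N) :
  \sum_(T in plane_trees r)
      x ^+ young r T r * (t - z) ^+ eld r T
        * z ^+ (n - young r T r - eld r T)
  = x * \prod_(1 <= k < n) (x + z *+ (n - k) + t *+ k).
Proof.
rewrite (sum_plane_trees (t - z) x z r hn); congr (_ * _).
rewrite /rising big_add1 big_mkord; apply: eq_bigr => k _.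
have kn : (k.+1 <= n)%N by have := ltn_ord k; rewrite -ltnS (prednK hn) => /ltnW.
rewrite -addrA -mulrS mulrnBl mulrnBr // -!addrA.
by congr (_ + (_ + _)); apply: addrC.
Qed.
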